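(* For every $n\ge1$ and every $X\in\mathfrak B^n$, the length of every cycle in the state transition diagram of $\mathfrak A(n,X)$ divides the number $C^{\star}(n,X)=2^{H(n,X)}(2^{\mathfrak C(n,X)}-1)$.
   Context: $\mathfrak B^n=\{0,1\}^n$ is regarded as $\mathbb F_2^n$; vectors are indexed $X=[X_0,\dots,X_{n-1}]$ with indices modulo $n$. For a rule $X\in\mathfrak B^n$, the additive cellular automaton $\mathfrak A(n,X)$ has state set $\mathfrak B^n$ and transition map the linear operator $\hat X$, $(\hat X*s)_i=\bigoplus_{k=0}^{n-1}X_k s_{i+k\bmod n}$; its state transition diagram is the directed graph on $\mathfrak B^n$ with edges $(s,\hat X*s)$. The discrete baker transformation $\mathfrak b:\mathfrak B^n\to\mathfrak B^n$ is defined by $(\mathfrak b*X)_i=\bigoplus_{j\in\{0,\dots,n-1\}:\ 2j\equiv i\ (\mathrm{mod}\ n)}X_j$ (an empty sum being $0$). The baker diagram of $\mathfrak B^n$ is the directed graph on $\mathfrak B^n$ with edges $(Y,\mathfrak b*Y)$. $H(n,X)$ is the distance from $X$ to the closest cyclic vertex of the baker diagram, i.e. the least $m\ge0$ such that $\mathfrak b^m*X$ lies on a cycle of $\mathfrak b$; $\mathfrak C(n,X)$ is the length of the cycle of the baker diagram in whose basin $X$ lies, i.e. of the cycle that the iterates $\mathfrak b^k*X$ eventually enter. *)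

(* Defs.v *)
From mathcomp Require Import all_boot all_order all_algebra.

Set Implicit Arguments.
Unset Strict Implicit.
Unset Printing Implicit Defensive.

Import GRing.Theory.

Local Open Scope ring_scope.

Section FunctionalGraph.
(* The directed graph on T with edges (x, f x) is the relation frel f. *)
Variables (T : finType) (f : T -> T).

(* fcycle accepts the empty sequence, hence the first conjunct. *)
Definition digraph_cycle (c : seq T) : bool :=
  [&& c != [::], fcycle f c & uniq c].

(* A boolean test; on_cycleP is the literal definition: some cycle contains x. *)
Definition on_cycle (x : T) : bool := digraph_cycle (orbit f x).

Lemma on_cycleP (x : T) :
  reflect (exists2 c, digraph_cycle c & x \in c) (on_cycle x).
Proof.
apply: (iffP idP) => [xc|[c /and3P[_ fc uc] xc]].
  by exists (orbit f x); rewrite // -fconnect_orbit connect0.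
rewrite /on_cycle /digraph_cycle orbit_uniq andbT; apply/andP; split.
  by rewrite -size_eq0 size_orbit -lt0n order_gt0.
by apply/(orbitPcycle 0 4); rewrite (iter_order_cycle fc xc xc).
Qed.

Lemma ex_on_cycle (x : T) : exists m, on_cycle (iter m f x).
Proof.
have /trajectP[i lt_i Ei] : iter (order f x) f x \in traject f x (order f x).
  exact: looping_order.
exists i; rewrite /on_cycle /digraph_cycle orbit_uniq andbT.
apply/andP; split; first by rewrite -size_eq0 size_orbit -lt0n order_gt0.
apply/(orbitPcycle 0 3); exists (order f x - i).-1.
by rewrite prednK ?subn_gt0 // -iterD subnK // ltnW.
Qed.

Definition cycle_dist (x : T) : nat := ex_minn (ex_on_cycle x).

(* The orbit of a vertex lying on a cycle is that cycle. *)
Definition cycle_length (x : T) : nat :=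
  size (orbit f (iter (cycle_dist x) f x)).

Lemma cycle_lengthE (x : T) (c : seq T) (k : nat) :
  digraph_cycle c -> iter k f x \in c -> cycle_length x = size c.
Proof.
move=> /and3P[_ fc uc] kc.
have : iter (k + cycle_dist x) f x \in c.
  rewrite addnC iterD; elim: (cycle_dist x) => //= m IH.
  by rewrite (eqP (next_cycle fc IH)) mem_next.
rewrite /cycle_length /cycle_dist; case: ex_minnP => m /on_cycleP.
case=> d /and3P[_ fd ud] md _; rewrite iterD => yc.
have yd : iter k f (iter m f x) \in d.
  by elim: k {kc yc} => //= k IH; rewrite (eqP (next_cycle fd IH)) mem_next.
by rewrite size_orbit (order_cycle fd ud md) -(order_cycle fd ud yd)
           (order_cycle fc uc yc).
Qed.

End FunctionalGraph.

Notation Bvec n := 'rV['F_2]_n.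

Section AdditiveCA.
Variable n : nat.

(* The sum i + k reduced modulo n; i : 'I_n witnesses 0 < n. *)
Definition shift_ord (i : 'I_n) (k : nat) : 'I_n :=
  Ordinal (ltn_pmod (i + k) (leq_ltn_trans (leq0n i) (ltn_ord i))).

Definition ca_step (X s : Bvec n) : Bvec n :=
  \row_(i < n) \sum_(k < n) X 0 k * s 0 (shift_ord i k).

Definition baker (X : Bvec n) : Bvec n :=
  \row_(i < n) \sum_(j < n | 2 * j == i %[mod n]) X 0 j.

Definition baker_height (X : Bvec n) : nat := cycle_dist baker X.

Definition baker_period (X : Bvec n) : nat := cycle_length baker X.

Definition Cstar (X : Bvec n) : nat :=
  (2 ^ baker_height X * (2 ^ baker_period X - 1))%N.

End AdditiveCA.

(* Main.v *)
(* In characteristic 2 squaring is additive, so the operator of [baker X] is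
   the square of the operator of [X].  The iterates of [baker] at [X] number
   H and H + C coincide; hence so do the powers 2^H and 2^(H+C) of the
   automaton map, and the length of each of its cycles divides the difference
   of these exponents. *)
Require Import Defs.
From mathcomp Require Import all_boot all_order all_algebra.

Set Implicit Arguments.
Unset Strict Implicit.
Unset Printing Implicit Defensive.

Import GRing.Theory.

Lemma size_cycle_dvdn (T : finType) (f : T -> T) (c : seq T) (x : T)
    (p : nat) :
  digraph_cycle f c -> x \in c -> iter p f x = x -> size c %| p.
Proof.
move=> /and3P[_ fc uc] xc fpx.
have fLx : iter (size c) f x = x.
  by rewrite -(order_cycle fc uc xc) (iter_order_cycle fc xc xc).
have fmulx q : iter (q * size c) f x = x.
  by elim: q => // q IH; rewrite mulSn iterD IH.
have c_gt0 : 0 < size c by case: (c) xc.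
have lt_r := ltn_pmod p c_gt0.
(* Full turns around [c] fix [x], so the remainder [p %% size c] does too; being below the order of
   [x], it equals the [findex] of [x] from itself, which is 0. *)
have := fpx; rewrite {1}(divn_eq p (size c)) addnC iterD fmulx => frx.
rewrite /dvdn -(findex_iter (f := f) (x := x) (i := p %% size c)).
  by rewrite frx findex0.
by rewrite (order_cycle fc uc xc).
Qed.

Lemma mem_iter_cycle (T : finType) (f : T -> T) (c : seq T) (x : T) (m : nat) :
  digraph_cycle f c -> x \in c -> iter m f x \in c.
Proof.
move=> /and3P[_ fc _] xc; elim: m => //= m IH.
by rewrite (eqP (next_cycle fc IH)) mem_next.
Qed.

Lemma iter_cycle_dist (T : finType) (f : T -> T) (x : T) :
  iter (cycle_length f x) f (iter (cycle_dist f x) f x)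
  = iter (cycle_dist f x) f x.
Proof.
rewrite /cycle_length size_orbit /cycle_dist; case: ex_minnP => m /on_cycleP.
by case=> c /and3P[_ fc _] mc _; rewrite (iter_order_cycle fc mc mc).
Qed.

Local Open Scope ring_scope.

(* Off-diagonal terms cancel in pairs. *)
Lemma sum_sym_pchar2 (R : nzRingType) (n : nat) (a : 'I_n -> 'I_n -> R) :
  2 \in [pchar R] -> (forall i j, a i j = a j i) ->
  \sum_i \sum_j a i j = \sum_i a i i.
Proof.
move=> R2 aC; under eq_bigr => i _.
  rewrite (bigD1 i) //= (bigID (fun j : 'I_n => (j < i)%N)) /=.
  over.
(* Exchanging the sums over [j > i] transposes that triangle onto the one where [j < i]. *)
rewrite !big_split /= [X in _ + (_ + X)](exchange_big_dep predT) //=.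
rewrite -[RHS]addr0; congr (_ + _); rewrite -big_split big1 //= => i _.
rewrite -[RHS](addrr_pchar2 R2 (\sum_(j | (j != i) && (j < i)%N) a i j)).
congr (_ + _); apply: eq_big => [j|j _]; last exact: aC.
by rewrite -leqNgt leq_eqVlt eq_sym -!(inj_eq val_inj) /=; case: ltngtP.
Qed.

Lemma mulrr_F2 (x : 'F_2) : x * x = x.
Proof. by apply/eqP; case: x => -[|[|]]. Qed.

Lemma shift_ordD (n : nat) (i : 'I_n) (j k : nat) :
  shift_ord (shift_ord i j) k = shift_ord i (j + k).
Proof. by apply: val_inj; rewrite /= modnDml addnA. Qed.

(** The double step has terms [X_k X_l s_(i+k+l)], symmetric in [k] and [l]. Only the diagonal
    [X_k^2 s_(i+2k)] survives, and [X_k^2 = X_k] in ['F_2]; [baker] groups these coefficients by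
    [2k] mod [n]. *)
Lemma ca_step_baker (n : nat) (X s : Bvec n) :
  ca_step (baker X) s = ca_step X (ca_step X s).
Proof.
apply/rowP => i; rewrite !mxE.
under [RHS]eq_bigr => k _.
  rewrite mxE mulr_sumr; under eq_bigr => l _ do rewrite shift_ordD mulrA.
  over.
rewrite sum_sym_pchar2 ?pchar_Fp // => [|k l]; last first.
  by rewrite addnC [X 0 k * _]mulrC.
under eq_bigr => k _ do rewrite mxE mulr_suml.
rewrite (exchange_big_dep predT) //=; apply: eq_bigr => j _.
(* Each [j] contributes to exactly one entry of [baker X], the one at [2j] mod [n]. *)
rewrite (big_pred1 (shift_ord j j)) => [|k].
  rewrite mulrr_F2; congr (_ * s 0 _); apply: val_inj.
  by rewrite /= modnDmr.
by rewrite /= -val_eqE /= addnn -mul2n eq_sym (modn_small (ltn_ord k)).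
Qed.

Lemma ca_step_iter_baker (n : nat) (X s : Bvec n) (m : nat) :
  ca_step (iter m (@baker n) X) s = iter (2 ^ m) (ca_step X) s.
Proof.
elim: m s => // m IH s.
by rewrite iterS ca_step_baker !IH -iterD addnn -mul2n expnS.
Qed.

Local Close Scope ring_scope.

Theorem theorem7 (n : nat) (hn : 0 < n) (X : Bvec n) (c : seq (Bvec n)) :
  digraph_cycle (ca_step X) c -> size c %| Cstar X.
Proof.
move=> cycle_c; have /hasP[s sc _] : has predT c.
  by rewrite has_predT lt0n size_eq0; case/and3P: cycle_c.
(* Starting from the iterate of [s] number [2^H] makes [Cstar X] further steps end at number
   [2^(H+C)]. *)
have yc := mem_iter_cycle (2 ^ baker_height X) cycle_c sc.
apply: (size_cycle_dvdn cycle_c yc).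
rewrite -iterD /Cstar mulnBr muln1 subnK; last first.
  by rewrite leq_pmulr // expn_gt0.
by rewrite -expnD -!ca_step_iter_baker addnC iterD iter_cycle_dist.
Qed.
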